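(* Let $s,t,n\in\mathbb{Z}^+$ with $1\leq s\leq t\leq n$. Let $\mathcal{Y}$ be a $t$-element subset of $[n]=\{1,\ldots,n\}$ chosen uniformly at random from all $t$-element subsets of $[n]$. Let $Y_s$ be the $s$th smallest element of $\mathcal{Y}$. Then: (1) $\mathbb{E}[Y_s]=\frac{s}{t+1}(n+1)$. (2) $\mathrm{Var}(Y_s)\leq\frac{n^2}{t}$. (3) $\mathbb{P}\left(\left|Y_s-\frac{s}{t+1}(n+1)\right|\leq\frac{n}{t^{1/3}}\right)\geq 1-t^{-1/3}$. *)

(* Defs.v *)
From mathcomp Require Import all_boot all_order all_algebra.
From mathcomp Require Import all_classical all_reals all_analysis.

Set Implicit Arguments.
Unset Strict Implicit.
Unset Printing Implicit Defensive.

Import Order.TTheory GRing.Theory Num.Theory.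
Import numFieldNormedType.Exports.

Local Open Scope classical_set_scope.
Local Open Scope ring_scope.

(* The ordinal [i : 'I_n], with value in {0, ..., n-1}, encodes the element
   i + 1 of [n] = {1, ..., n}; [s] counts from 1. The value is a junk 0 when
   A has fewer than s elements. *)
Definition kth_smallest (n s : nat) (A : {set 'I_n}) : nat :=
  nth 0%N (sort leq [seq (nat_of_ord i).+1 | i <- enum A]) s.-1.

(* [Y] is a random element of the finite type {set 'I_n} (with its discrete
   sigma-algebra) whose law is uniform on the t-element subsets. *)
Definition uniform_tsubset (d : measure_display) (T : measurableType d)
    (R : realType) (P : probability T R) (n t : nat) (Y : T -> {set 'I_n}) :
    Prop :=
  (forall A : {set 'I_n}, measurable (Y @^-1` [set A])) /\
  (forall A : {set 'I_n},
     P (Y @^-1` [set A]) =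
     (if #|A| == t then ('C(n, t)%:R : R)^-1 else 0)%:E).

Definition order_statistic (R : realType) (T : Type) (n s : nat)
    (Y : T -> {set 'I_n}) : T -> R :=
  fun w => (kth_smallest s (Y w))%:R.
Arguments order_statistic R {T n} s Y _.

(* Main.v *)
Require Import Defs.
From mathcomp Require Import all_boot all_order all_algebra.
From mathcomp Require Import all_classical all_reals all_analysis.
From mathcomp Require Import measurable_realfun ring lra zify.

Import Order.TTheory GRing.Theory Num.Theory.
Import numFieldNormedType.Exports.

Local Open Scope classical_set_scope.
Local Open Scope ring_scope.

(** Everything follows from the rising-factorial moments of Y_s.  Summed over
    the t-element subsets A of [n], and with s counted from 1,

      sum_A 'C(Y_s(A) + j - 1, j) = 'C(s + j - 1, j) * 'C(n + j, t + j),

    which is [sum_bin_kth_smallest].  This is proved by induction on n: the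
    subsets of [n + 1] that avoid n + 1 are the subsets of [n], and those that
    contain it are the sets B with n + 1 adjoined, whose s-th smallest element
    is that of B unless n + 1 itself has rank s.  In the first situation the
    right-hand side obeys the same recursion by Pascal's rule; in the second
    one the summand is constant and the formula is the subset-of-a-subset identity
    [mul_bin_bin].

    Dividing by 'C(n, t), the case j = 1 is the expectation, and j = 1 and
    j = 2 together give the exact variance

      s (t + 1 - s) (n + 1) (n - t) / ((t + 1)^2 (t + 2)),

    of which n^2 / t is a crude upper bound.  The concentration estimate is
    Chebyshev's inequality with deviation n / t^(1/3): the bound on the
    variance gives (n^2 / t) / (n / t^(1/3))^2 = t^(-1/3).

    In the lemmas the rank is s.+1 with s < t, so that s counts from 0 and no
    predecessor of s occurs. *)

(** * Subsets of [n + 1] in terms of subsets of [n] *)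

(** The map [lift ord_max] is the inclusion of [n] in [n + 1]: it preserves
    values and misses only the last point. *)
Definition lift_set {n} (B : {set 'I_n}) : {set 'I_n.+1} :=
  [set lift ord_max i | i in B]%SET.

Lemma ord_maxN_lift_set n (B : {set 'I_n}) : (ord_max \in lift_set B) = false.
Proof. by apply/imsetP => -[i _ /eqP]; rewrite (negPf (neq_lift _ _)). Qed.

Lemma card_lift_set n (B : {set 'I_n}) : #|lift_set B| = #|B|.
Proof. exact/card_imset/lift_inj. Qed.

Lemma preim_lift_setK n (A : {set 'I_n.+1}) :
  lift_set (lift ord_max @^-1: A)%SET = (A :\ ord_max)%SET.
Proof.
apply/setP => i; rewrite !inE; case: (unliftP ord_max i) => [j|] ->.
  rewrite mem_imset; last exact: lift_inj.
  by rewrite inE eq_sym neq_lift.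
by rewrite ord_maxN_lift_set eqxx.
Qed.

Lemma lift_set_preimK n (B : {set 'I_n}) :
  (lift ord_max @^-1: lift_set B)%SET = B.
Proof.
apply/setP => i; rewrite inE mem_imset; [by []|exact: lift_inj].
Qed.

Lemma lift_set_preimU n (B : {set 'I_n}) :
  (lift ord_max @^-1: (ord_max |: lift_set B))%SET = B.
Proof.
apply/setP => i; rewrite !inE mem_imset; last exact: lift_inj.
by rewrite eq_sym (negPf (neq_lift _ _)).
Qed.

(** Splitting on whether the largest element belongs to A is the set-level
    form of Pascal's rule. *)
Lemma sum_card_recr n t (G : {set 'I_n.+1} -> nat) :
  (\sum_(A : {set 'I_n.+1} | #|A| == t.+1) G A =
   \sum_(B : {set 'I_n} | #|B| == t.+1) G (lift_set B) +
   \sum_(B : {set 'I_n} | #|B| == t) G (ord_max |: lift_set B)%SET)%N.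
Proof.
rewrite (bigID (fun A : {set 'I_n.+1} => ord_max \in A)) /= addnC; congr addn.
  rewrite (reindex_onto lift_set (fun A => lift ord_max @^-1: A)%SET) /=.
    apply: eq_bigl => B.
    by rewrite card_lift_set ord_maxN_lift_set lift_set_preimK eqxx !andbT.
  move=> A /andP[_ mA]; rewrite preim_lift_setK.
  by apply/setP => i; rewrite !inE; case: eqVneq => // ->; rewrite (negPf mA).
rewrite (reindex_onto (fun B => ord_max |: lift_set B)%SET
  (fun A => lift ord_max @^-1: A)%SET) /=.
  apply: eq_bigl => B.
  rewrite cardsU1 card_lift_set ord_maxN_lift_set lift_set_preimU !inE !eqxx.
  by rewrite !andbT.
by move=> A /andP[_ mA]; rewrite preim_lift_setK finset.setD1K.
Qed.

(** * The s-th smallest element under this recursion *)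

Lemma perm_labels_lift_set n (B : {set 'I_n}) :
  perm_eq [seq (nat_of_ord i).+1 | i <- enum (lift_set B)]
          [seq (nat_of_ord i).+1 | i <- enum B].
Proof.
suff /(perm_map (fun i : 'I_n.+1 => (nat_of_ord i).+1)) :
    perm_eq (enum (lift_set B)) [seq lift ord_max i | i <- enum B].
  move=> /perm_trans; apply; rewrite -map_comp.
  rewrite (eq_map (g := fun i : 'I_n => (nat_of_ord i).+1))// => i.
  by congr S; exact: lift_max.
apply: uniq_perm => [||i]; rewrite ?enum_uniq ?map_inj_uniq ?enum_uniq//.
  exact: lift_inj.
rewrite mem_enum; apply/imsetP/mapP => -[j jB ->]; exists j => //.
  by rewrite mem_enum.
by rewrite -mem_enum.
Qed.

Lemma kth_smallest_lift_set n s (B : {set 'I_n}) :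
  kth_smallest s (lift_set B) = kth_smallest s B.
Proof.
congr nth; apply/perm_sortP; rewrite ?perm_labels_lift_set//.
- exact: leq_total.
- exact: leq_trans.
- exact: anti_leq.
Qed.

(** The adjoined point exceeds every element of B, so that it comes last in
    the sorted list of labels. *)
Lemma kth_smallest_lift_setU n s (B : {set 'I_n}) : (s <= #|B|)%N ->
  kth_smallest s.+1 (ord_max |: lift_set B) =
  if s == #|B| then n.+1 else kth_smallest s.+1 B.
Proof.
move=> sB; rewrite /kth_smallest /=.
set l := [seq _ | i <- enum B].
have -> : sort leq [seq (nat_of_ord i).+1 | i <- enum (ord_max |: lift_set B)%SET]
   = rcons (sort leq l) n.+1.
  apply: (sorted_eq leq_trans anti_leq).
  - exact/sort_sorted/leq_total.
  - rewrite (sorted_pairwise leq_trans) pairwise_rcons.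
    rewrite -(sorted_pairwise leq_trans) sort_sorted ?andbT; last exact: leq_total.
    by rewrite all_sort all_map; apply/allP => i _ /=; rewrite ltnS ltnW.
  - rewrite perm_sort; set g := (fun i : 'I_n.+1 => (nat_of_ord i).+1).
    apply: (@perm_trans _ (g ord_max :: map g (enum (lift_set B)))).
      rewrite -(map_cons g); apply: perm_map; apply: uniq_perm => [||i].
      - exact: enum_uniq.
      - by rewrite /= mem_enum ord_maxN_lift_set enum_uniq.
      - by rewrite mem_enum !inE mem_enum.
    rewrite perm_sym perm_rcons perm_cons perm_sort.
    by rewrite perm_sym perm_labels_lift_set.
rewrite nth_rcons size_sort size_map -cardE.
by rewrite ltn_neqAle sB andbT; case: eqVneq.
Qed.

(** * Rising-factorial moments, counted over all t-subsets *)

(** For t <= n both sides are the trinomial coefficient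
    (n + j)! / (j! t! (n - t)!); in all cases they count the nested pairs of a j-subset in a (t + j)-subset of [n + j]. *)
Lemma mul_bin_bin n t j :
  ('C(n + j, j) * 'C(n, t) = 'C(t + j, j) * 'C(n + j, t + j))%N.
Proof.
have [tn|nt] := leqP t n; last first.
  by rewrite (bin_small nt) muln0 (@bin_small (n + j)) ?muln0 ?ltn_add2r.
have h1 := bin_fact (leq_addl n j); rewrite addnK in h1.
have h2 := bin_fact tn.
have h3 := bin_fact (leq_addl t j); rewrite addnK in h3.
have h4 : (t + j <= n + j)%N by rewrite leq_add2r.
move: (bin_fact h4); rewrite subnDr => {}h4.
apply/eqP; rewrite -(eqn_pmul2r (m := (j`! * (t`! * (n - t)`!))%N)).
  apply/eqP; transitivity (n + j)`!%N.
    by rewrite -h1 -h2; lia.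
  by rewrite -h4 -h3; lia.
by rewrite !muln_gt0 !fact_gt0.
Qed.

(** Rising factorials are the right basis: they make the right-hand side a
    single product, so that the recursion on n closes. *)
Lemma sum_bin_kth_smallest n t s j : (s < t)%N ->
  (\sum_(A : {set 'I_n} | #|A| == t) 'C((kth_smallest s.+1 A + j).-1, j) =
   'C(s + j, j) * 'C(n + j, t + j))%N.
Proof.
elim: n t => [|n IH] [//|t] st.
  rewrite (@bin_small (0 + j)) ?ltn_add2r// muln0 big_pred0// => A.
  by apply/negbTE; rewrite neq_ltn ltnS (leq_trans (max_card _)) ?card_ord.
rewrite sum_card_recr addSn [(t.+1 + j)%N]addSn binS mulnDr; congr addn.
  by under eq_bigr do rewrite kth_smallest_lift_set; rewrite IH.
(* When s = t the adjoined point n.+1 is itself the element of rank s.+1. *)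
have [->|snt] := eqVneq s t.
  under eq_bigr => B /eqP Bt.
    rewrite kth_smallest_lift_setU ?Bt// eqxx addSn /=; over.
  rewrite sum_nat_const -mul_bin_bin mulnC; congr muln.
  by rewrite -cardsE card_draws card_ord.
under eq_bigr => B /eqP Bt.
  rewrite kth_smallest_lift_setU ?Bt// (negPf snt); over.
by rewrite IH// ltn_neqAle snt.
Qed.

Lemma sum_kth_smallest n t s : (s < t)%N ->
  (\sum_(A : {set 'I_n} | #|A| == t) kth_smallest s.+1 A =
   s.+1 * 'C(n.+1, t.+1))%N.
Proof.
move=> st; rewrite -[n.+1]addn1 -[t.+1]addn1 -[s.+1]addn1 -[X in (X * _)%N]bin1.
rewrite -sum_bin_kth_smallest//.
by apply: eq_bigr => A _; rewrite addn1 /= addn1 bin1.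
Qed.

(** The case j = 2, doubled to clear the denominator of 'C(Y + 1, 2). *)
Lemma sum_sqr_kth_smallest n t s : (s < t)%N ->
  (\sum_(A : {set 'I_n} | #|A| == t)
     (kth_smallest s.+1 A * kth_smallest s.+1 A + kth_smallest s.+1 A) =
   s.+1 * s.+2 * 'C(n.+2, t.+2))%N.
Proof.
move=> st; have bin2E m : (2 * 'C(m.+1, 2) = m * m.+1)%N.
  by rewrite -mul_bin_diag bin1 mulnC.
have := sum_bin_kth_smallest n t s 2 st; rewrite !addn2.
move=> /(congr1 (muln 2)); rewrite mulnA bin2E => <-.
rewrite big_distrr /=; apply: eq_bigr => A _.
by rewrite addn2 succnK bin2E mulnSr.
Qed.

(** * Finitely valued random elements *)

Section finite_random_elements.
Context (d : measure_display) (T : measurableType d) (R : realType)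
  (P : probability T R).

(** Measurability of the fibres suffices because a preimage is a finite union
    of them; this makes every function of Y measurable. *)
Lemma measurable_preimage_finite (F : finType) (Y : T -> F) (S : set F) :
  (forall a, measurable (Y @^-1` [set a])) -> measurable (Y @^-1` S).
Proof.
move=> mY; have -> : Y @^-1` S = \bigcup_(a in S) (Y @^-1` [set a]).
  by rewrite -preimage_bigcup bigcup_imset1 image_id.
by apply: fin_bigcup_measurable.
Qed.

Lemma integral_comp_finite (F : finType) (Y : T -> F) (f : F -> R) :
  (forall a, measurable (Y @^-1` [set a])) -> (forall a, 0 <= f a) ->
  (\int[P]_w (f (Y w))%:E = \sum_a (f a)%:E * P (Y @^-1` [set a]))%E.
Proof.
move=> mY f0.
transitivity (\int[P]_w (\sum_(a : F) (f a * \1_(Y @^-1` [set a]) w)%:E))%E.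
  apply: eq_integral => w _; rewrite (bigD1 (Y w))//= indicE mem_set// mulr1.
  rewrite big1 ?adde0// => a; rewrite eq_sym => /eqP aY.
  by rewrite indicE memNset ?mulr0.
rewrite ge0_integral_sum//.
- apply: eq_bigr => a _; rewrite (integralZl_indic measurableT (fun=> Y @^-1` [set a]))//.
    by rewrite integral_indic ?setIT.
  by move=> /(le_lt_trans (f0 a)); rewrite ltxx.
- move=> a.
  apply/measurable_EFinP; exact: measurable_funM.
- by move=> a w _; rewrite lee_fin mulr_ge0.
Qed.

Lemma integral_uniform_tsubset n t (Y : T -> {set 'I_n}) (f : {set 'I_n} -> R) :
  uniform_tsubset P t Y -> (forall A, 0 <= f A) ->
  (\int[P]_w (f (Y w))%:E =
   ((\sum_(A : {set 'I_n} | #|A| == t) f A) / 'C(n, t)%:R)%:E)%E.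
Proof.
move=> [mY PY] f0; rewrite integral_comp_finite//.
under eq_bigr do rewrite PY -EFinM.
rewrite sumEFin mulr_suml [in RHS]big_mkcond; congr EFin.
by apply: eq_bigr => A _; case: ifP; rewrite ?mulr0.
Qed.

(** * Expectation and variance of the order statistic *)

Lemma expectation_order_statistic n t s (Y : T -> {set 'I_n}) :
  (s < t <= n)%N -> uniform_tsubset P t Y ->
  ('E_P[order_statistic R s.+1 Y] = (s.+1%:R / t.+1%:R * n.+1%:R)%:E)%E.
Proof.
move=> /andP[st tn] uY; rewrite unlock /order_statistic.
rewrite (integral_uniform_tsubset _ _ _ (fun A => (kth_smallest s.+1 A)%:R) uY)//.
rewrite -natr_sum sum_kth_smallest//; congr EFin.
have := mul_bin_diag n.+1 t => /(congr1 (GRing.natmul (1 : R))).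
rewrite !natrM => binE.
have N0 : 'C(n, t)%:R != 0 :> R by rewrite pnatr_eq0 -lt0n bin_gt0.
have t0 : t.+1%:R != 0 :> R by rewrite pnatr_eq0.
apply: (mulfI t0); apply: (mulIf N0); rewrite -mulrA divfK// mulrCA -binE /=.
by field.
Qed.

(** The centred square expands as Y (Y + 1) - (1 + 2 mu) Y + mu^2, whose sum
    over the t-subsets is known from the first two rising-factorial moments. *)
Lemma variance_order_statistic n t s (Y : T -> {set 'I_n}) :
  (s < t <= n)%N -> uniform_tsubset P t Y ->
  ('V_P[order_statistic R s.+1 Y] =
  (s.+1%:R * (t%:R - s%:R) * n.+1%:R * (n%:R - t%:R) /
   (t.+1%:R ^+ 2 * t.+2%:R))%:E)%E.
Proof.
move=> stn uY; rewrite /variance covariance.unlock.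
rewrite (expectation_order_statistic _ _ _ _ stn uY)//= unlock.
move: stn => /andP[st tn]; set mu := (_ / _ * _).
have /= := integral_uniform_tsubset _ _ _
  (fun A => ((kth_smallest s.+1 A)%:R - mu) ^+ 2) uY (fun=> sqr_ge0 _).
rewrite [LHS](_ : _ = \int[P]_w ((order_statistic R s.+1 Y w - mu) ^+ 2)%:E)%E//.
move=> ->; congr EFin.
have -> : \sum_(A : {set 'I_n} | #|A| == t) ((kth_smallest s.+1 A)%:R - mu) ^+ 2
  = (s.+1 * s.+2 * 'C(n.+2, t.+2))%:R
    - (1 + 2 * mu) * (s.+1 * 'C(n.+1, t.+1))%:R + mu ^+ 2 * 'C(n, t)%:R.
  have -> : 'C(n, t) = \sum_(A : {set 'I_n} | #|A| == t) 1%N.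
    by rewrite sum1_card -cardsE card_draws card_ord.
  rewrite -sum_sqr_kth_smallest// -sum_kth_smallest//.
  rewrite !natr_sum !mulr_sumr -sumrB -big_split /=.
  by apply: eq_bigr => A _; rewrite natrD natrM; ring.
have := mul_bin_diag n.+1 t => /(congr1 (GRing.natmul (1 : R))).
have := mul_bin_diag n.+2 t.+1 => /(congr1 (GRing.natmul (1 : R))).
rewrite /= !natrM => bin2E bin1E.
have N0 : 'C(n, t)%:R != 0 :> R by rewrite pnatr_eq0 -lt0n bin_gt0.
have t1 : t.+1%:R != 0 :> R by rewrite pnatr_eq0.
have t2 : t.+2%:R != 0 :> R by rewrite pnatr_eq0.
have {}bin1E : 'C(n.+1, t.+1)%:R = n.+1%:R * 'C(n, t)%:R / t.+1%:R :> R.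
  by rewrite bin1E mulrC mulKf.
have {}bin2E : 'C(n.+2, t.+2)%:R =
    n.+2%:R * (n.+1%:R * 'C(n, t)%:R / t.+1%:R) / t.+2%:R :> R.
  by rewrite -bin1E bin2E mulrC mulKf.
rewrite bin1E bin2E /mu; move: t1 t2.
rewrite -[n.+2]addn2 -[n.+1]addn1 -[s.+2]addn2 -[s.+1]addn1 -[t.+2]addn2 -[t.+1]addn1.
rewrite !natrD => t1 t2; field.
by rewrite N0 t1 t2.
Qed.

(** The two factors of the numerator are bounded separately: (s + 1) (t - s) by
    (t + 1)^2 and (n + 1) (n - t) by n^2, the latter because t >= 1. *)
Lemma variance_order_statistic_le n t s (Y : T -> {set 'I_n}) :
  (s < t <= n)%N -> uniform_tsubset P t Y ->
  ('V_P[order_statistic R s.+1 Y] <= (n%:R ^+ 2 / t%:R)%:E)%E.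
Proof.
move=> stn uY; rewrite (variance_order_statistic _ _ _ _ stn uY) lee_fin.
move: stn => /andP[st tn].
have t0 : 0 < t%:R :> R by rewrite ltr0n (leq_ltn_trans _ st).
have s0 : 0 <= s%:R :> R by [].
have t1 : 1 <= t%:R :> R by rewrite ler1n (leq_ltn_trans _ st).
have {}st : s%:R + 1 <= t%:R :> R by rewrite natr1 ler_nat.
have {}tn : t%:R <= n%:R :> R by rewrite ler_nat.
rewrite -[n.+1]addn1 -[s.+1]addn1 -[t.+2]addn2 -[t.+1]addn1 !natrD.
move: (n%:R) (t%:R) (s%:R) => x y z in t0 s0 t1 st tn *.
rewrite ler_pdivrMr; last by rewrite mulr_gt0 ?exprn_gt0//; lra.
have h1 : (z + 1) * (y - z) <= (y + 1) ^+ 2 by nra.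
have h2 : (x + 1) * (x - y) <= x ^+ 2 by nra.
rewrite -[_ * (x + 1) * _]mulrA.
apply: (@le_trans _ _ ((y + 1) ^+ 2 * x ^+ 2)).
  by rewrite ler_pM// mulr_ge0//; lra.
have -> : x ^+ 2 / y * ((y + 1) ^+ 2 * (y + 2)) =
    (y + 1) ^+ 2 * x ^+ 2 * ((y + 2) / y) by field; rewrite gt_eqF.
apply: ler_peMr; first by rewrite mulr_ge0 ?sqr_ge0.
by rewrite ler_pdivlMr//; lra.
Qed.
End finite_random_elements.

(** * Chebyshev's inequality for the order statistic *)

Theorem proposition7p1 (R : realType) (d : measure_display)
    (T : measurableType d) (P : probability T R) (s t n : nat)
    (Y : T -> {set 'I_n}) :
  (1 <= s)%N -> (s <= t)%N -> (t <= n)%N ->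
  uniform_tsubset P t Y ->
  [/\ ('E_P[order_statistic R s Y] =
         (s%:R / t.+1%:R * n.+1%:R)%:E)%E,
      ('V_P[order_statistic R s Y] <= (n%:R ^+ 2 / t%:R)%:E)%E &
      ((1 - t%:R `^ (- 3^-1))%:E <=
         P [set w : T | (`| order_statistic R s Y w - s%:R / t.+1%:R * n.+1%:R |
                          <= n%:R / t%:R `^ (3^-1))%R])%E].
Proof.
case: s => // s _ st tn uY; have stn : (s < t <= n)%N by rewrite st.
have EY := expectation_order_statistic _ _ _ P _ _ _ _ stn uY.
have VY := variance_order_statistic_le _ _ _ P _ _ _ _ stn uY.
split=> //.
have mpreX (G : set R) : measurable (order_statistic R s.+1 Y @^-1` G).
  exact: (measurable_preimage_finite _ _ _ _
            [set A | G (kth_smallest s.+1 A)%:R] uY.1).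
have mX : measurable_fun setT (order_statistic R s.+1 Y).
  by move=> _ G _; rewrite setTI.
pose X : {RV P >-> R} := mfun_Sub (mem_set mX).
have t0 : 0 < t%:R :> R by rewrite ltr0n (leq_ltn_trans _ st).
have n0 : 0 < n%:R :> R by rewrite (lt_le_trans t0)// ler_nat.
set c := t%:R `^ 3^-1; have c0 : 0 < c by rewrite powR_gt0.
have c3 : c ^+ 3 = t%:R.
  by rewrite -powR_mulrn ?powR_ge0// -powRrM mulVf// powRr1// ltW.
have eps0 : 0 < n%:R / c by rewrite divr_gt0.
set A := [set w | _].
have mA : measurable A by exact: (mpreX [set x | `|x - _| <= _]).
rewrite powRN -/c.
(* The complement of A is the strict deviation event, which Chebyshev's
   inequality covers since it bounds the non-strict one. *)
have : (P (~` A) <= (c^-1)%:E)%E.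
  have := chebyshev X eps0; rewrite /= EY /= => cheb.
  apply: (@le_trans _ _ (P [set w | n%:R / c <=
      `|order_statistic R s.+1 Y w - s.+1%:R / t.+1%:R * n.+1%:R|])).
    apply: le_measure; rewrite ?inE//; first exact: measurableC.
      exact: (mpreX [set x | _ <= `|x - _|]).
    by move=> w /= /negP; rewrite -ltNge => /ltW.
  apply: (le_trans cheb).
  apply: (le_trans (lee_wpmul2l _ VY)).
    by rewrite lee_fin invr_ge0 sqr_ge0.
  rewrite -EFinM lee_fin -c3 le_eqVlt; apply/orP; left; apply/eqP.
  by field; rewrite (gt_eqF n0) (gt_eqF c0).
rewrite probability_setC// => h.
rewrite EFinB leeBlDr// -leeBlDl//.
exact: fin_num_measure.
Qed.
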